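(* For every $\gamma>0$ there is $p_0=p_0(\gamma)>0$ such that the following holds for every $p\in(0,p_0]$. Let $s\in\mathbb N$, let $F\in \mathbb R[x_1,\dots,x_s]$ be a multilinear polynomial which has nonnegative coefficients and zero constant coefficient, and let $\beta_1,\dots,\beta_s$ be i.i.d. $\operatorname{Bernoulli}(p)$ random variables. Then for any $t\in [0,\infty)$ and any real $\ell > 3^s t$, \[\Pr\big[|F(\beta_1,\dots,\beta_s)-\ell|\le t\big]\le \frac1e+\gamma.\]
   Context: A $\operatorname{Bernoulli}(p)$ random variable takes value $1$ with probability $p$ and $0$ otherwise. *)

(* Defs.v *)
From HB Require Import structures.
From mathcomp Require Import all_boot all_order all_algebra.
From mathcomp Require mpoly.
From mathcomp Require Import all_classical all_reals all_analysis.

Set Implicit Arguments.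
Unset Strict Implicit.
Unset Printing Implicit Defensive.

Import Order.TTheory GRing.Theory Num.Theory.

Local Open Scope classical_set_scope.
Local Open Scope ring_scope.

(* [mpoly] is not imported, because its notations clash with those of
   MathComp-Analysis: [mpoly.mpoly s R] is the type {mpoly R[s]},
   [mpoly.mcoeff m F] is the coefficient F@_m, [mpoly.mnm0] is the monomial 1,
   and [mpoly.meval v F] is the evaluation F.@[v]. *)

Definition multilinear (R : nzRingType) (s : nat) (F : mpoly.mpoly s R) : Prop :=
  forall m : mpoly.multinom s, mpoly.mcoeff m F != 0 ->
  forall i : 'I_s, (mpoly.fun_of_multinom m i <= 1)%N.

Definition nonneg_coeffs (R : numDomainType) (s : nat) (F : mpoly.mpoly s R) :
    Prop :=
  forall m : mpoly.multinom s, 0 <= mpoly.mcoeff m F.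

Definition mutually_independent (d : measure_display) (T : measurableType d)
    (R : realType) (P : probability T R) (I : finType) (X : I -> {RV P >-> R}) :
    Prop :=
  forall (J : {set I}) (A : I -> set R), (forall i, measurable (A i)) ->
    P (\bigcap_(i in [set` J]) (X i @^-1` A i)) =
    (\prod_(i in J) P (X i @^-1` A i))%E.

Definition is_bernoulli (d : measure_display) (T : measurableType d)
    (R : realType) (P : probability T R) (p : R) (X : {RV P >-> R}) : Prop :=
  P (X @^-1` [set 1]) = p%:E /\ P (X @^-1` [set 0]) = (1 - p)%:E.

(* Main.v *)
Require Import Defs.
From HB Require Import structures.
From mathcomp Require Import all_boot all_order all_algebra.
From mathcomp Require mpoly.
From mathcomp Require Import all_classical all_reals all_analysis.
From mathcomp Require Import measurable_realfun ring lra.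

Set Implicit Arguments.
Unset Strict Implicit.
Unset Printing Implicit Defensive.

Import Order.TTheory GRing.Theory Num.Theory.

Local Open Scope classical_set_scope.
Local Open Scope ring_scope.

(* Viewing F as a monotone supermodular function of the random set
   S = {i | beta_i = 1}, call a set M heavy if F(M) >= l - 3^(s - |M|) t, and call
   a set hit if it has a heavy subset. The empty set is not heavy, while S is
   heavy whenever |F(S) - l| <= t. Reveal the elements in a fixed order, keeping
   an unhit set W of drawn elements that skips every active j, i.e. every j for
   which W + j is hit. The evolution of W does not depend on the draws of the
   active elements, so given their number n, the number drawn is Binomial(n, p).
   If none is drawn then S is unhit. If two are drawn then S contains heavy sets
   M and N with M :&: N not heavy, and supermodularity forces F(S) > l + t. So
   |F(S) - l| <= t requires that exactly one is drawn, which has probability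
   n p (1 - p)^(n - 1) <= exp(p - 1). *)

(** * Averages over random sets and the active process *)

Lemma binomial_mass1_le (R : realType) (p : R) (n : nat) : 0 <= p <= 1 ->
  n%:R * p * (1 - p) ^+ n.-1 <= expR (p - 1).
Proof.
move=> /andP[p0 p1]; case: n => [|n]; first by rewrite !mul0r expR_ge0.
(* Both factors are bounded by 1 + x <= exp x, with x = (n+1)p - 1 and x = -p; the exponents (n+1)p
   - 1 and -np add up to p - 1. *)
have np : n.+1%:R * p <= expR (n.+1%:R * p - 1).
  by have := expR_ge1Dx (n.+1%:R * p - 1); rewrite addrC subrK.
have q : (1 - p) ^+ n <= expR (- p) ^+ n.
  by rewrite lerXn2r ?nnegrE ?expR_ge0 ?subr_ge0 ?expR_ge1Dx.
apply: (le_trans (ler_pM _ _ np q)) => /=.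
- by rewrite mulr_ge0.
- by rewrite exprn_ge0 ?subr_ge0.
by rewrite -expRM_natl -expRD ler_expR -natr1; lra.
Qed.

(** For duplicate-free [r], the expectation of [f] at [W] joined with a random subset of [r] that
    keeps each element with probability [p]. *)
Fixpoint bernoulli_mean (R : pzRingType) (I : finType) (p : R)
    (f : {set I} -> R) (r : seq I) (W : {set I}) : R :=
  if r is j :: r' then
    p * bernoulli_mean p f r' (j |: W) + (1 - p) * bernoulli_mean p f r' W
  else f W.

Lemma bernoulli_mean_eq0 (R : pzRingType) (I : finType) (p : R)
    (f : {set I} -> R) (r : seq I) (W : {set I}) :
  (forall S : {set I}, W \subset S -> f S = 0) -> bernoulli_mean p f r W = 0.
Proof.
elim: r W => [|j r IH] W f0 /=; first exact: f0.
rewrite !IH ?mulr0 ?addr0 // => S WS; apply: f0.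
by apply: (fintype.subset_trans _ WS); rewrite finset.subsetU1.
Qed.

(* Think of a process that reveals the elements of [r] one at a time and, from
   an unhit state [W], ignores every active element, that is, every [j] with
   [hit (j |: W)]. The reals [a] and [b] bound the probabilities that none,
   respectively exactly one, of the remaining active elements is drawn; the
   linear constraints say that prepending [n] active elements keeps the
   probability of exactly one below [expR (p - 1)], and they survive averaging. *)
Lemma active_process_bound (R : realType) (p : R) (I : finType)
    (hit E : pred {set I}) (r : seq I) (W : {set I}) :
  0 <= p <= 1 ->
  (forall A B : {set I}, A \subset B -> hit A -> hit B) ->
  (forall S, E S -> hit S) ->
  (forall (S V : {set I}) j k, E S -> ~~ hit V -> hit (j |: V) ->
     hit (k |: V) -> j != k -> ~~ (k |: (j |: V) \subset S)) ->
  uniq r -> ~~ hit W ->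
  exists a b : R,
  [/\ forall j, j \notin r -> hit (j |: W) ->
        bernoulli_mean p (fun S => (E S)%:R) r (j |: W) <= a,
      bernoulli_mean p (fun S => (E S)%:R) r W <= b &
      forall n, (1 - p) ^+ n * b + n%:R * p * (1 - p) ^+ n.-1 * a
        <= expR (p - 1)].
Proof.
move=> p01 hit_mono E_hit two_active.
have /andP[p0 p1] := p01; have q0 : 0 <= 1 - p by rewrite subr_ge0.
elim: r W => [|k r IH] W /=.
  (* Nothing is left to draw, and an unhit [W] violates [E]; the constraint is the binomial mass at
     one. *)
  move=> _ nW; exists 1, 0; split=> [j _ _||n]; first by case: (E _).
    by case: (boolP (E W)) => [/E_hit|//]; rewrite (negPf nW).
  by rewrite mulr0 add0r mulr1 binomial_mass1_le.
case/andP=> kr ur nW; have [a0 [b0 [ha0 hb0 hn0]]] := IH W ur nW.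
have [hk|nk] := boolP (hit (k |: W)).
  (* Drawing the active [k] together with another active [j] rules out [E], so [a] only keeps the
     case where [k] is not drawn. The constraint at [n] becomes the old one at [n.+1]. *)
  exists ((1 - p) * a0), (p * a0 + (1 - p) * b0); split.
  - move=> j; rewrite inE negb_or => /andP[jk jr] hj.
    rewrite bernoulli_mean_eq0 ?mulr0 ?add0r; last first.
      move=> S sS; case: (boolP (E S)) => // ES.
      by have := two_active S W j k ES nW hj hk jk; rewrite sS.
    by rewrite ler_wpM2l ?ha0.
  - by rewrite lerD // ler_wpM2l // ha0.
  - move=> n; have := hn0 n.+1; congr (_ <= _).
    by case: n => [|n]; rewrite /= ?exprS ?expr0 -?natr1; ring.
have [a1 [b1 [ha1 hb1 hn1]]] := IH _ ur nk.
(* Here [k] is not active: it enters the state when drawn, active elements stay active by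
   monotonicity, and the two cases average. *)
exists (p * a1 + (1 - p) * a0), (p * b1 + (1 - p) * b0); split.
- move=> j; rewrite inE negb_or => /andP[jk jr] hj.
  rewrite finset.setUCA lerD // ler_wpM2l ?ha0 ?ha1 //.
  by apply: hit_mono hj; rewrite finset.setUS // finset.subsetU1.
- by rewrite lerD // ler_wpM2l.
- move=> n; apply: (@le_trans _ _ (p * expR (p - 1) + (1 - p) * expR (p - 1))).
    apply: le_trans (lerD (ler_wpM2l p0 (hn1 n)) (ler_wpM2l q0 (hn0 n))).
    by rewrite le_eqVlt; apply/orP; left; apply/eqP; ring.
  by rewrite -mulrDl addrC subrK mul1r.
Qed.

(** * Polynomials on the Boolean cube and the window estimate *)

Definition cube_eval (R : comNzRingType) (s : nat) (F : mpoly.mpoly s R)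
    (S : {set 'I_s}) : R :=
  mpoly.meval (fun i => (i \in S)%:R) F.

(** At 0/1 points a monomial is the indicator that its support lies in [S], so monotonicity and
    supermodularity can be checked one indicator at a time. *)
Lemma cube_evalE (R : comNzRingType) (s : nat) (F : mpoly.mpoly s R)
    (S : {set 'I_s}) :
  cube_eval F S = \sum_(m <- mpoly.msupp F) mpoly.mcoeff m F *
    ([set i | mpoly.fun_of_multinom m i != 0%N]%SET \subset S)%:R.
Proof.
rewrite /cube_eval mpoly.mevalE; apply: eq_bigr => m _; congr (_ * _).
case: fintype.subsetP => [mS|/fintype.subsetP/subsetPn[i]].
  rewrite big1 // => i _; have := mS i; rewrite inE.
  by case: (mpoly.fun_of_multinom m i) => [|k] => // -> //; rewrite expr1n.
rewrite inE => mi iS; rewrite (bigD1 i) //= (negPf iS).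
by rewrite expr0n (negPf mi) mul0r.
Qed.

Lemma cube_eval0 (R : comNzRingType) (s : nat) (F : mpoly.mpoly s R) :
  mpoly.mcoeff (@mpoly.mnm0 s) F = 0 -> cube_eval F finset.set0 = 0.
Proof.
move=> Fz; rewrite cube_evalE big1 // => m _; rewrite finset.subset0.
case: eqP => [m0|_]; last by rewrite mulr0.
suff -> : m = @mpoly.mnm0 s by rewrite Fz mul0r.
apply/mpoly.mnmP => i; rewrite mpoly.mnm0E; apply/eqP.
by have := finset.in_set0 i; rewrite -m0 inE => /negbFE.
Qed.

Lemma cube_eval_mono (R : numDomainType) (s : nat) (F : mpoly.mpoly s R)
    (A B : {set 'I_s}) :
  nonneg_coeffs F -> A \subset B -> cube_eval F A <= cube_eval F B.
Proof.
move=> F0 AB; rewrite !cube_evalE; apply: ler_sum => m _.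
rewrite ler_wpM2l // ler_nat.
by case: (boolP (_ \subset A)) => // mA; rewrite (fintype.subset_trans mA AB).
Qed.

Lemma cube_eval_supermodular (R : numDomainType) (s : nat)
    (F : mpoly.mpoly s R) (A B : {set 'I_s}) :
  nonneg_coeffs F ->
  cube_eval F A + cube_eval F B <= cube_eval F (A :|: B) + cube_eval F (A :&: B).
Proof.
move=> F0; rewrite !cube_evalE -!big_split; apply: ler_sum => m _ /=.
rewrite -!mulrDr ler_wpM2l // -!natrD ler_nat finset.subsetI.
case: (boolP (_ \subset A)) => mA; case: (boolP (_ \subset B)) => mB //=.
- by rewrite (fintype.subset_trans mA) ?finset.subsetUl.
- by rewrite (fintype.subset_trans mA) ?finset.subsetUl.
- by rewrite (fintype.subset_trans mB) ?finset.subsetUr.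
Qed.

Lemma mean_window_le (R : realType) (p t l : R) (s : nat)
    (F : mpoly.mpoly s R) :
  0 <= p <= 1 -> nonneg_coeffs F -> mpoly.mcoeff (@mpoly.mnm0 s) F = 0 ->
  0 <= t -> 3 ^+ s * t < l ->
  bernoulli_mean p (fun S => (`|cube_eval F S - l| <= t)%R%:R) (enum 'I_s)
    finset.set0 <= expR (p - 1).
Proof.
move=> p01 F0 Fz t0 tl.
(* The base 3 makes [3 * slack N <= slack M] when [#|M| < #|N|]: the defect at a
   common proper subset of two heavy sets outweighs both of theirs plus [t]. *)
pose slack (M : {set 'I_s}) : R := 3 ^+ (s - #|M|) * t.
pose heavy (M : {set 'I_s}) := l - slack M <= cube_eval F M.
pose hit (S : {set 'I_s}) := [exists M : {set 'I_s}, (M \subset S) && heavy M].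
have t_slack M : t <= slack M.
  by rewrite -[leLHS]mul1r ler_wpM2r // exprn_ege1 // ler1n.
have card_le (M : {set 'I_s}) : (#|M| <= s)%N.
  by rewrite -[leqRHS](card_ord s) max_card.
have slack_mono (M N : {set 'I_s}) : (#|M| < #|N|)%N -> 3 * slack N <= slack M.
  move=> MN; rewrite /slack mulrA -exprS ler_wpM2r //.
  by rewrite ler_eXn2l ?ltr1n // ltn_sub2l // (leq_trans MN).
(* The only candidate is the empty set, where F vanishes while l - 3^s t is positive. *)
have nhit0 : ~~ hit finset.set0.
  apply/existsP => -[M /andP[]]; rewrite finset.subset0 => /eqP ->.
  by rewrite /heavy /slack cards0 subn0 cube_eval0 //; lra.
pose E (S : {set 'I_s}) := `|cube_eval F S - l| <= t.
have [|A B AB /existsP[M /andP[MA hM]]|S ES|S V j k ES nV| | |a [b [_ hb]]] :=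
    @active_process_bound R p 'I_s hit E (enum 'I_s) finset.set0 => //.
- by apply/existsP; exists M; rewrite (fintype.subset_trans MA AB).
- apply/existsP; exists S; rewrite subxx /= /heavy; have := t_slack S.
  by move: ES; rewrite /E ler_distl => /andP[]; lra.
- move=> /existsP[M /andP[MV hM]] /existsP[N /andP[NV hN]] jk.
  apply/negP => VS.
  have new (i : 'I_s) (K : {set 'I_s}) : K \subset i |: V -> heavy K -> i \in K.
    move=> KV hK; apply: contraNT nV => iK; apply/existsP; exists K.
    rewrite hK andbT; apply/fintype.subsetP => x xK.
    move/fintype.subsetP: KV => /(_ x xK); rewrite !inE => /orP[/eqP xi|//].
    by rewrite xi (negPf iK) in xK.
  have jM := new _ _ MV hM; have kN := new _ _ NV hN.
  have MNV : M :&: N \subset V.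
    apply/fintype.subsetP => x; rewrite inE => /andP[xM xN].
    move/fintype.subsetP: MV => /(_ x xM); rewrite !inE => /orP[/eqP xj|//].
    move/fintype.subsetP: NV => /(_ x xN); rewrite !inE => /orP[/eqP xk|//].
    by rewrite -xj xk eqxx in jk.
  have light : cube_eval F (M :&: N) < l - slack (M :&: N).
    rewrite ltNge; apply/negP => h; move/existsP: nV; apply.
    by exists (M :&: N); rewrite MNV.
  have jNV : j \notin V.
    by apply: contra nV => jV; apply/existsP; exists M; rewrite hM andbT;
      apply: (fintype.subset_trans MV); rewrite finset.subUset finset.sub1set jV subxx.
  have kNV : k \notin V.
    by apply: contra nV => kV; apply/existsP; exists N; rewrite hN andbT;
      apply: (fintype.subset_trans NV); rewrite finset.subUset finset.sub1set kV subxx.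
  have cM : (#|M :&: N| < #|M|)%N.
    apply: proper_card; rewrite properE finset.subsetIl; apply/subsetPn.
    by exists j => //; apply: contra jNV; apply: (fintype.subsetP MNV).
  have cN : (#|M :&: N| < #|N|)%N.
    apply: proper_card; rewrite properE finset.subsetIr; apply/subsetPn.
    by exists k => //; apply: contra kNV; apply: (fintype.subsetP MNV).
  have MNS : M :|: N \subset S.
    apply: fintype.subset_trans VS; rewrite finset.subUset; apply/andP; split.
      by rewrite (fintype.subset_trans MV) ?finset.subsetU1.
    by rewrite (fintype.subset_trans NV) // finset.setUS // finset.subsetU1.
  (* F(S) >= F(M) + F(N) - F(M :&: N) > l + slack(M :&: N) - slack M - slack N. Averaging the two
     [slack_mono] bounds makes this at least l + (slack M + slack N)/2 >= l + t. *)
  have := cube_eval_supermodular M N F0; have := cube_eval_mono F0 MNS.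
  have := slack_mono _ _ cM; have := slack_mono _ _ cN.
  have := t_slack M; have := t_slack N; move: hM hN light ES.
  by rewrite /heavy /E ler_distl => hM hN light /andP[]; lra.
- exact: enum_uniq.
- by move=> /(_ 0%N); rewrite expr0 mul1r !mul0r addr0; apply: le_trans.
Qed.

(** * From the probability space to the finite average *)

Lemma bernoulli_support (d : measure_display) (T : measurableType d)
    (R : realType) (P : probability T R) (p : R) (X : {RV P >-> R}) :
  is_bernoulli p X ->
  P (~` ((X @^-1` [set 1]) `|` (X @^-1` [set 0]))) = 0%E.
Proof.
move=> [X1 X0].
have mX (y : R) : measurable (X @^-1` [set y]) by exact: measurable_funPTI.
rewrite probability_setC; last exact: measurableU.
have dis : X @^-1` [set 1] `&` X @^-1` [set 0] = set0.
  by apply/seteqP; split => // w [/= -> /eqP]; rewrite oner_eq0.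
rewrite measureU //; transitivity (1 - (p%:E + (1 - p)%:E))%E.
  by congr (_ - (_ + _))%E.
by rewrite -EFinD (addrC p) subrK subrr.
Qed.

(** [r] lists the coordinates not yet revealed. *)
Definition cylinder (T : Type) (R : pzRingType) (I : finType)
    (X : I -> T -> R) (r : seq I) (A : {set I}) : set T :=
  \bigcap_(i in [set` [set i | i \notin r]%SET]) (X i @^-1` [set (i \in A)%:R]).

Lemma probability_cylinder (d : measure_display) (T : measurableType d)
    (R : realType) (P : probability T R) (I : finType) (p : R)
    (X : I -> {RV P >-> R}) (r : seq I) (A : {set I}) :
  mutually_independent X -> (forall i, is_bernoulli p (X i)) ->
  P (cylinder X r A) =
    (\prod_(i | i \notin r) (if i \in A then p else 1 - p))%:E.
Proof.
move=> indep bern.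
rewrite /cylinder (indep _ (fun i => [set (i \in A)%:R])) //.
rewrite -prodEFin; apply: eq_big => [i|i _]; first by rewrite inE.
by have [] := bern i; case: (i \in A).
Qed.

(** Revealing the head of [r] splits the cylinder as [bernoulli_mean] recurses; once all is
    revealed, independence gives the weight. *)
Lemma probability_le_bernoulli_mean (d : measure_display)
    (T : measurableType d) (R : realType) (P : probability T R) (I : finType)
    (p : R) (X : I -> {RV P >-> R}) (E : pred {set I}) (V : set T)
    (r : seq I) (A : {set I}) :
  mutually_independent X -> (forall i, is_bernoulli p (X i)) ->
  measurable V ->
  (forall w (S : {set I}), (forall i, X i w = (i \in S)%:R) -> V w -> E S) ->
  uniq r -> {in A, forall i, i \notin r} ->
  (P (V `&` cylinder X r A) <=
    (\prod_(i | i \notin r) (if i \in A then p else 1 - p) *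
      bernoulli_mean p (fun S => (E S)%:R) r A)%:E)%E.
Proof.
move=> indep bern mV VE.
have mX i (y : R) : measurable (X i @^-1` [set y]) by exact: measurable_funPTI.
have mcyl r' B : measurable (cylinder X r' B).
  exact: fin_bigcap_measurable.
elim: r A => [|j r IH] A /=.
  move=> _ _; have [EA|nEA] := boolP (E A).
    rewrite mulr1 -(probability_cylinder [::] A indep bern).
    by rewrite le_measure ?inE //; exact: measurableI.
  rewrite mulr0 (_ : V `&` _ = set0) ?measure0 //.
  apply/seteqP; split => // w [Vw cw]; case/negP: nEA.
  by apply: (VE w) => // i; apply: cw; rewrite /= !inE.
case/andP=> jr ur Ar.
have jA : j \notin A by apply/negP => /Ar; rewrite mem_head.
(* The variables are 0/1-valued only almost surely, so the two refined cylinders cover up to this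
   null event. *)
pose N := ~` ((X j @^-1` [set 1]) `|` (X j @^-1` [set 0])).
have mN : measurable N by apply: measurableC; exact: measurableU.
have prodE (B : {set I}) : B =i A \/ B =i j |: A ->
    \prod_(i | i \notin r) (if i \in B then p else 1 - p) =
    (if j \in B then p else 1 - p) *
      \prod_(i | i \notin j :: r) (if i \in A then p else 1 - p).
  move=> BA; rewrite (bigD1 j) //=; congr (_ * _).
  apply: eq_big => [i|i /andP[_ ij]]; first by rewrite inE negb_or andbC.
  by case: BA => -> //; rewrite !inE (negPf ij).
have IH1 : (P (V `&` cylinder X r (j |: A)) <= (p *
    \prod_(i | i \notin j :: r) (if i \in A then p else 1 - p) *
      bernoulli_mean p (fun S => (E S)%:R) r (j |: A))%:E)%E.
  have := IH (j |: A) ur; rewrite prodE ?finset.setU11; last by right.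
  apply=> i; rewrite !inE => /orP[/eqP -> //|/Ar].
  by rewrite inE negb_or => /andP[].
have IH0 : (P (V `&` cylinder X r A) <= ((1 - p) *
    \prod_(i | i \notin j :: r) (if i \in A then p else 1 - p) *
      bernoulli_mean p (fun S => (E S)%:R) r A)%:E)%E.
  have := IH A ur; rewrite prodE ?(negPf jA); last by left.
  by apply=> i /Ar; rewrite inE negb_or => /andP[].
have cover : V `&` cylinder X (j :: r) A `<=`
    ((V `&` cylinder X r (j |: A)) `|` (V `&` cylinder X r A)) `|` N.
  move=> w [Vw cw].
  have cw' i : i \notin r -> i != j -> X i w = (i \in A)%:R.
    by move=> ir ij; apply: cw; rewrite /= !inE negb_or ij.
  have [X1|n1] := pselect (X j w = 1).
    left; left; split=> // i; rewrite /= inE => ir.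
    by have [->|ij] := eqVneq i j; rewrite !inE ?eqxx //= (negPf ij) cw'.
  have [X0|n0] := pselect (X j w = 0).
    left; right; split=> // i; rewrite /= inE => ir.
    by have [->|ij] := eqVneq i j; rewrite ?(negPf jA) // cw'.
  by right=> -[].
have mI (B : {set I}) r' : measurable (V `&` cylinder X r' B).
  exact: measurableI.
have le1 := le_measure P _ _ cover; rewrite !inE in le1.
apply: le_trans (le1 _ _) _ => //.
  by apply: measurableU => //; exact: measurableU.
apply: le_trans (measureU2 _ _ _) _ => //; first exact: measurableU.
rewrite [X in (_ + X)%E](bernoulli_support (bern j)) adde0.
apply: le_trans (measureU2 _ _ _) _ => //.
apply: le_trans (leeD IH1 IH0) _.
rewrite -EFinD lee_fin le_eqVlt; apply/orP; left; apply/eqP; ring.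
Qed.

Theorem theorem6p1 (R : realType) (gamma : R) (hgamma : 0 < gamma) :
  exists2 p0 : R, 0 < p0 &
  forall p : R, 0 < p -> p <= p0 ->
  forall (s : nat) (F : mpoly.mpoly s R),
    multilinear F -> nonneg_coeffs F -> mpoly.mcoeff (@mpoly.mnm0 s) F = 0 ->
  forall (d : measure_display) (T : measurableType d) (P : probability T R)
    (beta : 'I_s -> {RV P >-> R}),
    mutually_independent beta -> (forall i, is_bernoulli p (beta i)) ->
  forall t l : R, 0 <= t -> 3 ^+ s * t < l ->
    (P [set w | `|mpoly.meval (fun i => beta i w) F - l| <= t]%R
       <= ((expR 1)^-1 + gamma)%:E)%E.
Proof.
pose e1 : R := (expR 1)^-1.
have e1_gt0 : 0 < e1 by rewrite invr_gt0 expR_gt0.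
(* The second term solves exp(p - 1) = 1/e + gamma and is positive since ln(1/e + gamma) > -1; the
   first keeps [p] a probability. *)
exists (Num.min 1 (1 + ln (e1 + gamma))).
  rewrite lt_min ltr01 /= -ltrBlDl sub0r -(expRK (-1)) expRN.
  by rewrite ltr_ln ?posrE ?ltrDl // addr_gt0.
move=> p p_gt0; rewrite le_min => /andP[p1 pg] s F _ F0 Fz d T P X indep bern.
move=> t l t0 tl.
have p01 : 0 <= p <= 1 by rewrite ltW.
set V := [set w | _].
have mV : measurable V.
  have mF : measurable_fun setT
      (fun w => `|mpoly.meval (fun i => X i w) F - l|).
    apply/measurableT_comp => //; apply: measurable_funB => //.
    under eq_fun do rewrite mpoly.mevalE.
    apply: measurable_sum => m; apply: measurable_funM => //.
    by apply: measurable_prod => i _; exact: measurable_funX.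
  rewrite (_ : V = setT `&` (fun w => `|mpoly.meval (fun i => X i w) F - l|) @^-1`
      `]-oo, t]); last by apply/seteqP; split=> w /=; rewrite in_itv //= => -[].
  exact: mF.
have V_le := @probability_le_bernoulli_mean d T R P 'I_s p X
  (fun S => (`|cube_eval F S - l| <= t)%R) V (enum 'I_s) finset.set0
  indep bern mV.
have cyl : cylinder X (enum 'I_s) finset.set0 = setT.
  by apply/seteqP; split=> // w _ i; rewrite /= inE mem_enum.
rewrite cyl setIT big_pred0 ?mul1r in V_le; last first.
  by move=> i; rewrite mem_enum.
apply: le_trans (V_le _ (enum_uniq _) _) _.
- by move=> w S XS; rewrite /V /= /cube_eval (mpoly.meval_eq F XS).
- by move=> i; rewrite inE.
rewrite lee_fin; apply: le_trans (mean_window_le p01 F0 Fz t0 tl) _.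
by rewrite -[leRHS]lnK ?posrE ?addr_gt0 // ler_expR lerBlDl.
Qed.
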